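(* Let $m=1$, $\mathbb{K}=\mathbb{R}$ and $k$ even. Suppose that $W_{\bm q}$ is surjective and let $p\in\bm q\text{-}\mathrm{Sym}_{k,n+1}$ be non-zero, $\psi_{\bm q}(p)=\sum_{j=0}^{hk}\binom{hk}{j}c_jZ_0^{hk-j}Z_1^j$ and $H=\operatorname{Hankel}(\bm c)$ the Hankel matrix of $\bm c=(c_j)_{j=0}^{hk}$. Then $p$ has a positive $\bm q$-Symmetric decomposition if and only if $H$ is positive semidefinite. Furthermore, in this case $p$ has a positive $\bm q$-Symmetric decomposition of length $r=\mathrm{rank}(H)$.
   Context: Let $n,k,h$ be positive integers. $\mathcal{S}^d(\mathbb{R}^{N+1})$ is the space of real homogeneous polynomials (forms) of degree $d$ in $N+1$ variables. Variables are $\bm X=(X_0,\dots,X_n)$ for $\mathcal{S}^k(\mathbb{R}^{n+1})$ and $\bm Z=(Z_0,Z_1)$ for binary forms. $\langle \bm v,\bm X\rangle=\sum_i v_iX_i$. Let $\bm q=(q_0,\dots,q_n)$ with $q_i\in\mathcal{S}^h(\mathbb{R}^{2})$. $W_{\bm q}:\mathcal{S}^k(\mathbb{R}^{n+1})\to\mathcal{S}^{hk}(\mathbb{R}^{2})$ is the linear map $\bm X^{\bm\alpha}\mapsto \prod_iq_i(\bm Z)^{\alpha_i}$. The apolar product on degree $d$ forms is $\langle f,g\rangle_d=\sum_{\bm\alpha}\binom{d}{\bm\alpha}^{-1}f_{\bm\alpha}g_{\bm\alpha}$ (where $f_{\bm\alpha},g_{\bm\alpha}$ are the monomial coefficients and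 $\binom{d}{\bm\alpha}=\frac{d!}{\prod\alpha_i!}$), and $A_d$ is the isomorphism $f\mapsto\langle f,\cdot\rangle_d$ onto the dual space. Put $\phi_{\bm q}=A_k^{-1}\circ W_{\bm q}^*\circ A_{hk}$, with $W_{\bm q}^*$ the transpose of $W_{\bm q}$, and $\bm q\text{-}\mathrm{Sym}_{k,n+1}:=\mathrm{Im}(\phi_{\bm q})$. When $W_{\bm q}$ is surjective, $\phi_{\bm q}$ is injective and $\psi_{\bm q}:\bm q\text{-}\mathrm{Sym}_{k,n+1}\to\mathcal{S}^{hk}(\mathbb{R}^{2})$ denotes its inverse. $\operatorname{Hankel}(\bm c)$ is the $(hk/2+1)\times(hk/2+1)$ matrix with entries $c_{i+j}$. A positive $\bm q$-Symmetric decomposition of length $r\in\mathbb{N}$ of a non-zero $p\in\bm q\text{-}\mathrm{Sym}_{k,n+1}$ is an expression $p=\sum_{i=1}^r\lambda_i\langle\bm q(\bm\xi_i),\bm X\rangle^k$ with $\lambda_1,\dots,\lambda_r>0$ and $\bm\xi_1,\dots,\bm\xi_r\in\mathbb{R}^{2}$ corresponding to different points of $\mathbb{P}^1(\mathbb{R})$. *)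

(* Defs.v *)
From HB Require Import structures.
From mathcomp Require Import all_boot all_order all_algebra.
From mathcomp Require Import reals.
From mathcomp Require Export mpoly.

Set Implicit Arguments.
Unset Strict Implicit.
Unset Printing Implicit Defensive.

Import Order.TTheory GRing.Theory Num.Theory.

Local Open Scope ring_scope.

(* S^d(R^{N+1}): the library's finite dimensional space of d-homogeneous
   polynomials in N.+1 variables. *)
Notation hform R N d := (dhomog N.+1 R d).

Section Apolar.
Variables (R : realType) (N d : nat).
Implicit Types f g : hform R N d.

Definition multinomial (a : 'X_{1..N.+1}) : R :=
  (mdeg a)`!%:R / (\prod_(i < N.+1) (a i)`!)%:R.

(* The bound [d.+1] on the total degree only makes the index type finite. *)
Definition apolar f g : R :=
  \sum_(a : 'X_{1..N.+1 < d.+1} | mdeg a == d)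
     (multinomial a)^-1 * (mpoly_of_dhomog f)@_a * (mpoly_of_dhomog g)@_a.

Lemma form_coeffP c f g (a : 'X_{1..N.+1}) :
  (mpoly_of_dhomog (c *: f + g))@_a =
  c * (mpoly_of_dhomog f)@_a + (mpoly_of_dhomog g)@_a.
Proof. by rewrite mpoly_of_dhomog_is_linear mcoeffD mcoeffZ. Qed.

Lemma apolar_linear f : linear (apolar f : hform R N d -> R^o).
Proof.
move=> c g h; rewrite /apolar scaler_sumr -big_split /=.
by apply: eq_bigr => a _; rewrite form_coeffP mulrDr mulrCA.
Qed.

HB.instance Definition _ f :=
  GRing.isLinear.Build R (hform R N d) R^o _ (apolar f) (apolar_linear f).

Definition apolar_fun f : 'Hom(hform R N d, R^o) :=
  linfun (apolar f : _ -> R^o).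

Lemma apolar_funE f g : apolar_fun f g = apolar f g.
Proof. exact: lfunE. Qed.

Lemma apolar_fun_linear : linear apolar_fun.
Proof.
move=> c f g; apply/lfunP => h.
rewrite add_lfunE scale_lfunE !apolar_funE /apolar scaler_sumr -big_split /=.
apply: eq_bigr => a _; rewrite form_coeffP mulrDr mulrDl.
by rewrite /GRing.scale /= mulrCA !mulrA.
Qed.

HB.instance Definition _ :=
  GRing.isLinear.Build R (hform R N d) 'Hom(hform R N d, R^o) _
    apolar_fun apolar_fun_linear.

(* A_d : f |-> <f, .>_d *)
Definition apolar_iso : 'Hom(hform R N d, 'Hom(hform R N d, R^o)) :=
  linfun apolar_fun.

Lemma apolar_isoE f g : apolar_iso f g = apolar f g.
Proof. by rewrite lfunE apolar_funE. Qed.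

Lemma multinomial_neq0 a : multinomial a != 0.
Proof.
rewrite mulf_neq0 ?invr_neq0 // pnatr_eq0 -lt0n ?fact_gt0 //.
by apply: prodn_gt0 => i; apply: fact_gt0.
Qed.

Lemma apolar_iso_ker : lker apolar_iso = 0%VS.
Proof.
apply/eqP/lker0P; apply: raddf_inj => f f0; apply/val_inj/mpolyP => a.
rewrite [RHS]mcoeff0 /=.
have [da|nda] := eqVneq (mdeg a) d; last first.
  exact: (dhomog_nemf_coeff (dhomog_is_dhomog f)).
have Xa : 'X_[a] \is [in R[N.+1], d.-homog] by rewrite dhomogX; apply/eqP.
have lta : (mdeg a < d.+1)%N by rewrite da.
have := apolar_isoE f (DHomog Xa); rewrite f0 zero_lfunE /apolar.
rewrite (bigD1 (BMultinom lta)) /=; last by rewrite da.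
rewrite mcoeffX eqxx mulr1 big1 => [|b /andP[_ nab]]; last first.
  rewrite mcoeffX [a == _](_ : _ = false) ?mulr0 //.
  by apply/negbTE; apply: contraNneq nab => ab; apply/eqP/val_inj.
move/esym/eqP; rewrite addr0 mulf_eq0 invr_eq0.
by rewrite (negPf (multinomial_neq0 a)) => /eqP.
Qed.

Lemma apolar_iso_img : limg apolar_iso = fullv.
Proof.
apply/eqP; rewrite eqEdim subvf /= limg_dim_eq ?apolar_iso_ker ?capv0 //.
by rewrite !dimvf /dim /= muln1.
Qed.

End Apolar.

Section QSym.
Variables (R : realType) (n m k h : nat) (q : 'I_n.+1 -> hform R m h).

Definition subst_q (f : {mpoly R[n.+1]}) : {mpoly R[m.+1]} :=
  f \mPo [tuple mpoly_of_dhomog (q i) | i < n.+1].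

Lemma subst_q_homog (f : hform R n k) :
  subst_q f \is [in R[m.+1], (h * k).-homog].
Proof.
rewrite /subst_q comp_mpolyEX big_seq rpred_sum // => a a_f.
rewrite rpredZ // comp_mpolyX.
have <- : mdeg a = k by exact: (dhomog_mf (dhomog_is_dhomog f) a_f).
rewrite mdegE big_distrr /=; elim/big_rec2: _ => [|i d p _ IHp].
  exact: dhomog1.
by rewrite dhomogM // tnth_mktuple dhomogMn // dhomog_is_dhomog.
Qed.

Definition W_fun (f : hform R n k) : hform R m (h * k) :=
  DHomog (subst_q_homog f).

Lemma W_fun_linear : linear W_fun.
Proof. by move=> c f g; apply: val_inj; rewrite /= /subst_q !linearP. Qed.

HB.instance Definition _ :=
  GRing.isLinear.Build R (hform R n k) (hform R m (h * k)) _ W_fun W_fun_linear.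

Definition W : 'Hom(hform R n k, hform R m (h * k)) := linfun W_fun.

Definition Wt_fun (l : 'Hom(hform R m (h * k), R^o)) : 'Hom(hform R n k, R^o) :=
  (l \o W)%VF.

Lemma Wt_fun_linear : linear Wt_fun.
Proof. by move=> c l1 l2; rewrite /Wt_fun comp_lfunDl comp_lfunZl. Qed.

HB.instance Definition _ :=
  GRing.isLinear.Build R 'Hom(hform R m (h * k), R^o) 'Hom(hform R n k, R^o) _
    Wt_fun Wt_fun_linear.

Definition W_transpose :
    'Hom('Hom(hform R m (h * k), R^o), 'Hom(hform R n k, R^o)) :=
  linfun Wt_fun.

(* [apolar_iso] is bijective (lemmas [apolar_iso_ker] and [apolar_iso_img]), so
   the inverse below is a genuine two-sided inverse. *)
Definition phi : 'Hom(hform R m (h * k), hform R n k) :=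
  ((apolar_iso R n k)^-1 \o (W_transpose \o apolar_iso R m (h * k)))%VF.

Lemma apolar_phi (f : hform R m (h * k)) (g : hform R n k) :
  apolar (phi f) g = apolar f (W g).
Proof.
rewrite -apolar_isoE -[RHS]apolar_isoE !comp_lfunE limg_lfunVK.
  by rewrite lfunE /= comp_lfunE.
by rewrite apolar_iso_img memvf.
Qed.

Definition qSym : {vspace hform R n k} := limg phi.

(* [phi^-1] inverts [phi] on its image [qSym]; the values outside [qSym], where
   the mathematical psi is undefined, are never used. *)
Definition psi : 'Hom(hform R n k, hform R m (h * k)) := (phi^-1)%VF.

Definition q_eval (xi : 'rV[R]_m.+1) : 'rV[R]_n.+1 :=
  \row_i (mpoly_of_dhomog (q i)).@[xi 0].

Definition linear_form (v : 'rV[R]_n.+1) : {mpoly R[n.+1]} :=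
  \sum_(i < n.+1) v 0 i *: 'X_i.

Definition same_proj_point (u v : 'rV[R]_m.+1) : Prop :=
  exists2 c : R, c != 0 & v = c *: u.

Definition has_pos_qSym_decomp (p : hform R n k) (r : nat) : Prop :=
  exists (lambda : 'I_r -> R) (xi : 'I_r -> 'rV[R]_m.+1),
    [/\ forall i, 0 < lambda i,
        forall i, xi i != 0,
        forall i j, i != j -> ~ same_proj_point (xi i) (xi j) &
        mpoly_of_dhomog p =
          \sum_(i < r) lambda i *: linear_form (q_eval (xi i)) ^+ k].

End QSym.

(* The square Hankel matrix of c_0, ..., c_d for d even; its entries only
   involve these terms of the sequence. *)
Definition Hankel (R : realType) (d : nat) (c : nat -> R) : 'M[R]_(d./2.+1) :=
  \matrix_(i, j) c (i + j)%N.

Definition psd (R : realType) (N : nat) (H : 'M[R]_N) : Prop :=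
  H^T = H /\ forall x : 'rV[R]_N, 0 <= (x *m H *m x^T) 0 0.

(* Main.v *)
(* The reproducing property of the apolar product gives
   phi (<xi, Z>^(h k)) = <q(xi), X>^k, so, phi being injective, decomposing p
   amounts to writing c_j = sum_i lambda_i xi_i0^(hk-j) xi_i1^j for j <= h k,
   that is, H = sum_i lambda_i v_i^T v_i with v_i on the rational normal curve.
   Such an H is positive semidefinite.  Conversely, a vector v of the curve lies
   in the row space of H as soon as the kernel of H, seen as a space of binary
   forms of degree D = h k / 2, vanishes at the corresponding point; then
   H - t v^T v is again a positive semidefinite Hankel matrix, of rank one less,
   for a suitable t > 0, and its row space no longer contains v.

   A common zero of the kernel: let L be the linear functional x^j |-> c_j.  If
   no kernel polynomial has degree D, the point at infinity is a common zero.
   Otherwise the nonzero kernel polynomial Q of least degree divides all the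
   others.  If Q = ((x - a)^2 + b^2) Q1 with b <> 0, then
   0 = L(Q Q1) = L(((x - a) Q1)^2) + b^2 L(Q1^2) puts Q1 in the kernel,
   contradicting minimality; so Q has a real root, or is constant and H = 0. *)

From HB Require Import structures.
Require Import Defs.
From mathcomp Require Import all_boot all_order all_algebra.
From mathcomp Require Import boolp reals.
From mathcomp Require Import complex zify ring lra.

Set Implicit Arguments.
Unset Strict Implicit.
Unset Printing Implicit Defensive.

Import Order.TTheory GRing.Theory Num.Theory.
Local Open Scope ring_scope.

(** * Real factors of a real polynomial *)

(** Take a complex root a + ib. If b is nonzero, the remainder of p modulo the real quadratic with
    this root has degree at most 1 and a nonreal zero, so it vanishes. *)
Lemma real_quadratic_factor (R : rcfType) (p : {poly R}) :
  (1 < size p)%N ->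
  (exists x, root p x) \/
  (exists a b (p1 : {poly R}),
     [/\ b != 0, p = (('X - a%:P) ^+ 2 + (b ^+ 2)%:P) * p1 &
         size p = (size p1).+2]).
Proof.
move=> p_gt1.
have : size (map_poly (real_complex R) p) != 1%N.
  by rewrite size_map_poly neq_ltn p_gt1 orbT.
case/closed_rootP=> -[a b] rootz.
have [b0|b_neq0] := eqVneq b 0.
  left; exists a; move: rootz; rewrite b0.
  by rewrite -[Complex a 0]/(real_complex R a) fmorph_root.
right; set s := ('X - a%:P) ^+ 2 + (b ^+ 2)%:P.
have size_s : size s = 3%N.
  rewrite size_polyDl size_exp_XsubC // size_polyC.
  by case: (_ == _).
have s_neq0 : s != 0 by rewrite -size_poly_gt0 size_s.
suff mod0 : modp p s = 0.
  exists a, b, (divp p s); split=> //.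
    by rewrite [LHS](divp_eq p s) mod0 addr0 mulrC.
  by rewrite size_divp // size_s subn2; case: (size p) p_gt1 => [|[]].
have size_mod : (size (modp p s) <= 2)%N by rewrite -ltnS -size_s ltn_modp.
have sz : (map_poly (real_complex R) s).[Complex a b] = 0.
  rewrite rmorphD rmorphXn /= rmorphB /= map_polyX !map_polyC /= !hornerE /=.
  by apply/eqP; rewrite eq_complex /=; apply/andP; split; apply/eqP; ring.
move: rootz; rewrite /root {1}(divp_eq p s) rmorphD rmorphM /= hornerD hornerM.
rewrite sz mulr0 add0r => mz.
(* Written as m0 + m1 x, the remainder has imaginary part m1 b at a + ib, whence m1 = 0 and then m0
   = 0. *)
rewrite -(take_poly_id size_mod) /take_poly /= in mz *.
move: mz; rewrite poly_def !big_ord_recr big_ord0 /= add0r expr0 expr1.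
rewrite rmorphD /= !linearZ /= rmorph1 map_polyX !hornerE /=.
rewrite eq_complex /= => /andP[/eqP re0 /eqP im0].
have m1 : (modp p s)`_1 = 0.
  apply/eqP; rewrite -(mulrI_eq0 _ (mulfI b_neq0)); apply/eqP; lra.
have m0 : (modp p s)`_0 = 0 by rewrite m1 in re0; lra.
by rewrite m0 m1 !scale0r addr0.
Qed.

(** * The functional x^j |-> c_j and its kernel *)

Section Riesz.
Variables (R : realType) (c : nat -> R) (D : nat).
Implicit Types p g : {poly R}.

Definition riesz p : R := \sum_(i < size p) p`_i * c i.

Lemma rieszE n p : (size p <= n)%N -> riesz p = \sum_(i < n) p`_i * c i.
Proof.
move=> le_pn; rewrite /riesz (big_ord_widen n (fun i => p`_i * c i)) //.
rewrite big_mkcond; apply: eq_bigr => i _; case: ltnP => // le_pi.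
by rewrite nth_default ?mul0r.
Qed.

Lemma riesz_linear : linear (riesz : {poly R} -> R^o).
Proof.
move=> a p g; pose n := maxn (size p) (size g).
rewrite !(@rieszE n) ?leq_maxl ?leq_maxr //; last first.
  by rewrite (leq_trans (size_polyD _ _)) // geq_max (leq_trans (size_scale_leq _ _))
    ?leq_maxl ?leq_maxr.
rewrite scaler_sumr -big_split; apply: eq_bigr => i _ /=.
by rewrite coefD coefZ mulrDl -mulrA.
Qed.

HB.instance Definition _ :=
  GRing.isLinear.Build R {poly R} R^o _ (riesz : _ -> R^o) riesz_linear.

Lemma rieszD p g : riesz (p + g) = riesz p + riesz g.
Proof. exact: (raddfD (riesz : {poly R} -> R^o)). Qed.

Lemma rieszZ a p : riesz (a *: p) = a * riesz p.
Proof. exact: (linearZ_LR (riesz : {linear {poly R} -> R^o})). Qed.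

Lemma riesz_sum (I : finType) (F : I -> {poly R}) :
  riesz (\sum_i F i) = \sum_i riesz (F i).
Proof. exact: (raddf_sum (riesz : {linear {poly R} -> R^o})). Qed.

Lemma rieszXn j : riesz 'X^j = c j.
Proof.
rewrite (@rieszE j.+1) ?size_polyXn // big_ord_recr big1 /= => [|i _].
  by rewrite coefXn eqxx add0r mul1r.
by rewrite coefXn (ltn_eqF (ltn_ord i)) mul0r.
Qed.

Definition riesz_nonneg : Prop :=
  forall p, (size p <= D.+1)%N -> 0 <= riesz (p * p).

(** The kernel of the Hankel matrix in polynomial form. Binary forms of degree D appear
    dehomogenised, so a zero coefficient of index D means a zero at infinity. *)
Definition riesz_ker p : Prop :=
  (size p <= D.+1)%N /\ forall g, (size g <= D.+1)%N -> riesz (p * g) = 0.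

Lemma riesz_kerB p g : riesz_ker p -> riesz_ker g -> riesz_ker (p - g).
Proof.
move=> [sp kp] [sg kg]; split=> [|f sf].
  by rewrite (leq_trans (size_polyD _ _)) // geq_max size_polyN sp.
by rewrite mulrBl -scaleN1r rieszD rieszZ kp // kg // mulr0 addr0.
Qed.

Lemma riesz_kerZ a p : riesz_ker p -> riesz_ker (a *: p).
Proof.
move=> [sp kp]; split=> [|f sf]; first exact: leq_trans (size_scale_leq _ _) sp.
by rewrite -scalerAl rieszZ kp // mulr0.
Qed.

Lemma riesz_ker0 : riesz_ker 0.
Proof.
split=> [|g _]; first by rewrite size_poly0.
by rewrite mul0r -(scale0r 0) rieszZ mul0r.
Qed.

Lemma riesz_kerD p g : riesz_ker p -> riesz_ker g -> riesz_ker (p + g).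
Proof.
by move=> kp kg; rewrite -[g]opprK -[- g]sub0r; do 2!apply: riesz_kerB => //;
  exact: riesz_ker0.
Qed.

Hypothesis L_ge0 : riesz_nonneg.

(** When L(p^2) = 0, L((g + t p)^2) is affine in t with slope 2 L(p g); being nonnegative for every
    t, it has slope 0. *)
Lemma riesz_ker_sqr p :
  (size p <= D.+1)%N -> riesz (p * p) = 0 -> riesz_ker p.
Proof.
move=> sp p0; split=> // g sg; apply/eqP/contraT => pg_neq0.
(* This t brings L((g + t p)^2) to -1. *)
pose t := - (riesz (g * g) + 1) / (2 * riesz (p * g)).
have := @L_ge0 (g + t *: p).
rewrite (leq_trans (size_polyD _ _)); last first.
  by rewrite geq_max sg (leq_trans (size_scale_leq _ _)).
move=> /(_ isT).
have -> : (g + t *: p) * (g + t *: p) =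
    g * g + (2 * t) *: (p * g) + (t ^+ 2) *: (p * p).
  by rewrite -!mul_polyC !rmorphM /= polyCMn polyC1; ring.
rewrite !rieszD !rieszZ p0 mulr0 addr0.
have -> : 2 * t * riesz (p * g) = - (riesz (g * g) + 1) by rewrite /t; field.
lra.
Qed.

(** L((X p)^2) = L(p * X^2 p) is zero because the size bound keeps X^2 p within degree D. Hence X p
    is only allowed to reach degree D - 1. *)
Lemma riesz_kerXM p : riesz_ker p -> ((size p).+1 < D.+1)%N -> riesz_ker ('X * p).
Proof.
move=> [sp kp] lt_p.
have size_X (f : {poly R}) n : (size f <= n)%N -> (size ('X * f)%R <= n.+1)%N.
  by move=> sf; rewrite mulrC (leq_trans (size_polyMleq _ _)) // size_polyX addn2.
apply: riesz_ker_sqr; first by apply: leq_trans (size_X _ _ (leqnn _)) _; exact: ltnW.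
rewrite (_ : 'X * p * _ = p * ('X * ('X * p))); last by ring.
by apply: kp; apply: leq_trans lt_p; apply/size_X/size_X.
Qed.

(** Horner's scheme on g, one multiplication by X at a time. For nonzero factors the bound limits
    the product to degree D - 1. *)
Lemma riesz_kerM p g :
  riesz_ker p -> (size p + size g <= D.+1)%N -> riesz_ker (p * g).
Proof.
move=> kp.
elim/poly_ind: g => [_|g a IHg]; first by rewrite mulr0; exact: riesz_ker0.
have [->|g_neq0] := eqVneq g 0.
  by rewrite mul0r add0r mulrC mul_polyC => _; exact: riesz_kerZ.
rewrite size_MXaddC (negPf g_neq0) /= addnS => le_pg.
rewrite mulrDr [p * a%:P]mulrC mul_polyC; apply: riesz_kerD; last exact: riesz_kerZ.
rewrite mulrA mulrC; apply: riesz_kerXM; first by apply: IHg; rewrite ltnW.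
rewrite (leq_ltn_trans _ le_pg) // (leq_ltn_trans (size_polyMleq _ _)) //.
by rewrite ltn_predL addn_gt0 [in X in _ || X]size_poly_gt0 g_neq0 orbT.
Qed.

Lemma riesz_ker_common_zero :
  [\/ forall p, riesz_ker p -> p`_D = 0,
      exists x, forall p, riesz_ker p -> root p x |
      forall j, (j <= D.*2)%N -> c j = 0].
Proof.
have [top|/existsNP[p0 /not_implyP[kp0 /eqP p0D]]] :=
  pselect (forall p, riesz_ker p -> p`_D = 0); first by constructor 1.
have p0_neq0 : p0 != 0 by apply: contraNneq p0D => ->; rewrite coef0.
pose P n := `[< exists2 Q, riesz_ker Q & Q != 0 /\ size Q = n >].
have exP : exists n, P n by exists (size p0); apply/asboolP; exists p0.
case: (ex_minnP exP) => e /asboolP[Q kQ [Q_neq0 <-]] {e} minQ.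
have small_ker p : riesz_ker p -> (size p < size Q)%N -> p = 0.
  move=> kp; rewrite ltnNge => /negP nQp; apply/eqP/negP => /negP p_neq0.
  by apply/nQp/minQ/asboolP; exists p.
(* [riesz_kerM] cannot put Q A in the kernel when its degree is D. Instead the remainder S = p - Q A
   satisfies L(S^2) = L(p S) - L(Q (A S)) = 0, so S is in the kernel and is zero by minimality of
   Q. *)
have dvdQ p : riesz_ker p -> p = divp p Q * Q.
  move=> [sp kp]; rewrite [LHS](divp_eq p Q).
  set A := divp p Q; set S := modp p Q.
  have sS : (size S < size Q)%N by rewrite ltn_modp.
  suff -> : S = 0 by rewrite addr0.
  apply: (small_ker _ _ sS); have [sQ0 {}kQ] := kQ.
  have sS' : (size S <= D.+1)%N by rewrite ltnW // (leq_trans sS).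
  apply: riesz_ker_sqr => //.
  have SE : S = p - Q * A.
    by rewrite [X in X - _](divp_eq p Q) -/A -/S mulrC addrC addKr.
  rewrite {2}SE.
  rewrite mulrBr -scaleN1r rieszD rieszZ [S * p]mulrC kp // add0r.
  rewrite mulrCA kQ ?mulr0 // (leq_trans (size_polyMleq _ _)) //.
  rewrite size_divp //; move: sS sp sQ0 {minQ small_ker}.
  by move: (size S) (size p) (size Q) => u v w; lia.
have [Q1|Q_neq1] := eqVneq (size Q) 1%N.
  constructor 3.
  have /size_poly1P[a a_neq0 Qa] : size Q == 1%N by rewrite Q1.
  have k1 : riesz_ker 1.
    have -> : 1 = a^-1 *: Q by rewrite -mul_polyC Qa -polyCM mulVf.
    exact: riesz_kerZ.
  (* Multiples of 1 only give degrees below D; [p0], whose coefficient of index D is nonzero,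
     supplies the top power. *)
  have kXD : riesz_ker 'X^D.
    have drop_p0 : drop_poly D p0 = (p0`_D)%:P.
      rewrite [LHS]size1_polyC ?coef_drop_poly ?add0n //.
      by rewrite size_drop_poly leq_subLR addn1; have [] := kp0.
    have -> : 'X^D = (p0`_D)^-1 *: (p0 - 1 * take_poly D p0).
      rewrite -{2}(poly_take_drop D p0) mul1r addrC addKr drop_p0 mul_polyC.
      by rewrite scalerA mulVf // scale1r.
    apply/riesz_kerZ/riesz_kerB => //; apply: riesz_kerM => //.
    by rewrite size_poly1 add1n ltnS size_take_poly.
  have kX i : (i <= D)%N -> riesz_ker 'X^i.
    rewrite leq_eqVlt => /orP[/eqP -> //|lt_iD]; rewrite -['X^i]mul1r.
    by apply: riesz_kerM => //; rewrite size_poly1 size_polyXn add1n.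
  (* An index j up to 2D splits into two exponents at most D, the first of which gives a kernel
     element. *)
  move=> j le_j; have [_ kj] := kX (minn j D) (geq_minr _ _).
  have <- : (minn j D + (j - minn j D))%N = j by rewrite subnKC // geq_minl.
  rewrite -rieszXn exprD kj // size_polyXn; lia.
have Q_gt1 : (1 < size Q)%N by rewrite ltn_neqAle eq_sym Q_neq1 size_poly_gt0.
case: (real_quadratic_factor Q_gt1) => [[x Qx]|[a [b [Q1 [b_neq0 QE sQ]]]]].
  by constructor 2; exists x => p /dvdQ ->; rewrite rootM Qx orbT.
have [sQ0 {}kQ] := kQ.
have sQ1 : ((size Q1).+1 < D.+1)%N by rewrite -sQ.
have sQ1' : (size Q1 <= D.+1)%N by rewrite ltnW // ltnW.
have := kQ _ sQ1'.
have -> : Q * Q1 = ('X - a%:P) * Q1 * (('X - a%:P) * Q1) + (b ^+ 2) *: (Q1 * Q1).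
  by rewrite [in LHS]QE -mul_polyC; ring.
have := @L_ge0 _ sQ1'; have := @L_ge0 (('X - a%:P) * Q1).
have sXQ1 : (size (('X - a%:P) * Q1)%R <= D.+1)%N.
  by rewrite (leq_trans (size_polyMleq _ _)) // size_XsubC ltnW.
move=> /(_ sXQ1).
rewrite rieszD rieszZ => l1 l2 /eqP.
rewrite paddr_eq0 ?l1 ?(mulr_ge0 (sqr_ge0 b) l2) // => /andP[_].
rewrite mulf_eq0 sqrf_eq0 (negPf b_neq0) /= => /eqP Q1_0.
have Q10 : Q1 = 0 by apply: small_ker; [exact: riesz_ker_sqr|rewrite sQ].
by move: Q_neq0; rewrite QE Q10 mulr0 eqxx.
Qed.

End Riesz.

(** * Positive semidefinite matrices and rank-one deflation *)

Lemma mx11E (R : pzRingType) (A B : 'M[R]_1) : A 0 0 = B 0 0 -> A = B.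
Proof. by move=> AB; apply/matrixP => i j; rewrite !ord1. Qed.

Lemma row_sqr (R : pzRingType) (N : nat) (b : 'rV[R]_N) :
  (b *m b^T) 0 0 = \sum_i b 0 i ^+ 2.
Proof. by rewrite mxE; apply: eq_bigr => i _; rewrite mxE. Qed.

(* [0 <= f (t b - x)] for all [t], where [b = x H], forces [b = 0]. *)
Lemma psd_isotropic (R : realType) (N : nat) (H : 'M[R]_N) (x : 'rV[R]_N) :
  psd H -> (x *m H *m x^T) 0 0 = 0 -> x *m H = 0.
Proof.
move=> [symH H_ge0] x0; set b := x *m H.
have bxT : b *m H *m x^T = b *m b^T by rewrite -mulmxA /b trmx_mul symH.
have xbT : x *m H *m b^T = b *m b^T by [].
pose e : R := (b *m H *m b^T) 0 0; pose s : R := (b *m b^T) 0 0.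
have e_ge0 : 0 <= e by exact: H_ge0.
have s_sum : s = \sum_i b 0 i ^+ 2 by exact: row_sqr.
have quad t : 0 <= t * (t * e) - 2 * t * s.
  have := H_ge0 (t *: b - x).
  have -> : (t *: b - x) *m H *m (t *: b - x)^T =
     t *: (t *: (b *m H *m b^T)) - (2 * t) *: (b *m b^T) + x *m H *m x^T.
    rewrite !mulmxBl linearB linearZ /= !mulmxBr -!scalemxAl -!scalemxAr bxT xbT.
    move: (b *m H *m b^T) (b *m b^T) (x *m H *m x^T) => A B X.
    by apply/matrixP => i j; rewrite !mxE; ring.
  have entry (A B X : 'M[R]_1) : (t *: (t *: A) - (2 * t) *: B + X) 0 0 =
      t * (t * A 0 0) - 2 * t * B 0 0 + X 0 0 by rewrite !mxE.
  by rewrite entry x0 addr0.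
have s0 : s = 0.
  have e1 : e + 1 != 0 by rewrite gt_eqF // (ltr_wpDl e_ge0 ltr01).
  (* The minimiser would be s / e; the denominator e + 1 also covers e = 0 and still gives a
     negative value unless s = 0. *)
  have := quad (s / (e + 1)).
  have -> : s / (e + 1) * (s / (e + 1) * e) - 2 * (s / (e + 1)) * s =
     - (e + 2) * (s / (e + 1)) ^+ 2 by field.
  move=> q_ge0; apply/eqP; have : (s / (e + 1)) ^+ 2 = 0.
    by have := sqr_ge0 (s / (e + 1)); clear -e_ge0 q_ge0; nra.
  by move/eqP; rewrite sqrf_eq0 mulf_eq0 invr_eq0 (negPf e1) orbF.
apply/rowP => i; rewrite [RHS]mxE; apply/eqP; rewrite -sqrf_eq0.
move/eqP: s0; rewrite s_sum psumr_eq0 => [/allP/(_ i)|j _]; last exact: sqr_ge0.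
by rewrite mem_index_enum => /(_ isT).
Qed.

(** Write v = u H and take t = 1 / (u H u^T), so that H' annihilates u. Modulo u every x is
    orthogonal to v, where H' and H define the same form. If v were in the row space of H', then v
    u^T = 0, contradicting u H u^T > 0. *)
Lemma psd_deflate (R : realType) (N : nat) (H : 'M[R]_N) (v : 'rV[R]_N) :
  psd H -> v != 0 -> (v <= H)%MS ->
  exists2 t, 0 < t &
    let H' := H - t *: (v^T *m v) in
    [/\ psd H', \rank H = (\rank H').+1, (H' <= H)%MS & ~~ (v <= H')%MS].
Proof.
move=> psdH v_neq0 /submxP[u vE]; have [symH H_ge0] := psdH.
pose s : R := (v *m u^T) 0 0.
have sE : s = (u *m H *m u^T) 0 0 by rewrite /s vE.
have s_gt0 : 0 < s.
  rewrite lt0r {2}sE H_ge0 andbT; apply: contraNneq v_neq0 => s0.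
  by rewrite vE psd_isotropic // -sE.
have vu : v *m u^T = s%:M by apply: mx11E; rewrite [RHS]mxE eqxx.
have uv : u *m v^T = s%:M by rewrite -[LHS]trmxK trmx_mul trmxK vu tr_scalar_mx.
have Hu : H *m u^T = v^T by rewrite vE trmx_mul symH.
exists s^-1; rewrite ?invr_gt0 //; set H' := H - _ => /=.
have symH' : H'^T = H' by rewrite linearB linearZ /= trmx_mul trmxK symH.
have uH' : u *m H' = 0.
  rewrite mulmxBr -vE -scalemxAr mulmxA uv mul_scalar_mx scalerA mulVf ?gt_eqF //.
  by rewrite scale1r subrr.
have H'u : H' *m u^T = 0 by rewrite -symH' -trmx_mul uH' trmx0.
have leH' : (H' <= H)%MS.
  by rewrite addmx_sub // -scaleNr scalemx_sub // vE !mulmxA submxMl.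
have nvH' : ~~ (v <= H')%MS.
  apply/negP => /submxP[w wE]; move: (gt_eqF s_gt0).
  by rewrite /s wE -mulmxA H'u mulmx0 mxE eqxx.
split=> //.
(* This a makes x - a u orthogonal to v. *)
- split=> // x; pose a : R := (x *m v^T) 0 0 / s.
  have xE : x *m H' *m x^T = (x - a *: u) *m H' *m (x - a *: u)^T.
    have -> : (x - a *: u)^T = x^T - a *: u^T by rewrite linearB linearZ.
    rewrite mulmxBl -scalemxAl uH' scaler0 subr0.
    have -> : x *m H' *m (x^T - a *: u^T) = x *m H' *m x^T - a *: (x *m (H' *m u^T)).
      by rewrite mulmxBr -scalemxAr mulmxA.
    by rewrite H'u mulmx0 scaler0 subr0.
  have yv : (x - a *: u) *m v^T = 0.
    rewrite mulmxBl -scalemxAl uv; apply: mx11E; rewrite !mxE /a.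
    by rewrite mulr1n divfK ?gt_eqF // !mxE subrr.
  rewrite xE /H' mulmxBr mulmxBl -scalemxAr -scalemxAl mulmxA yv.
  by rewrite !mul0mx scaler0 subr0.
- apply/eqP; rewrite eqn_leq; apply/andP; split.
    have -> : H = H' + s^-1 *: (v^T *m v) by rewrite subrK.
    apply: leq_trans (mxrank_add _ _) _; rewrite -[X in (_ <= X)%N]addn1 leq_add2l.
    apply: leq_trans (mxrank_scale _ _) _.
    exact: leq_trans (mxrankM_maxr _ _) (rank_leq_row _).
  suff : (H' < H)%MS by rewrite ltmxErank leH'.
  rewrite /ltmx leH' /=; apply: contra nvH' => leH.
  by apply: submx_trans leH; rewrite vE submxMl.
Qed.

(** * Hankel matrices and the rational normal curve *)

(** Indexed by the half degree D, which avoids halving in the types; [Hankel d] is convertible to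
    the case D = [d./2]. *)
Definition hankel (R : realType) (D : nat) (c : nat -> R) : 'M[R]_D.+1 :=
  \matrix_(i, j) c (i + j)%N.

(* The coefficients of the [D]-th power of the linear form [xi], without their
   binomial weights. *)
Definition veronese (R : realType) (D : nat) (xi : 'rV[R]_2) : 'rV[R]_D.+1 :=
  \row_i (xi 0 0 ^+ (D - i) * xi 0 1 ^+ i).

Section Hankel.
Variables (R : realType) (D : nat).
Implicit Types (c : nat -> R) (x y : 'rV[R]_D.+1) (xi : 'rV[R]_2).

Lemma rVpolyE x : rVpoly x = \sum_i x 0 i *: 'X^i.
Proof.
by rewrite [in LHS](row_sum_delta x) linear_sum; apply: eq_bigr => i _;
  rewrite linearZ /= rVpoly_delta.
Qed.

Lemma horner_rVpoly_sum x a : (rVpoly x).[a] = \sum_i x 0 i * a ^+ i.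
Proof.
rewrite rVpolyE horner_sum; apply: eq_bigr => i _.
by rewrite hornerZ hornerXn.
Qed.

Lemma hankel_riesz c x y :
  (x *m hankel D c *m y^T) 0 0 = riesz c (rVpoly x * rVpoly y).
Proof.
rewrite mxE; under eq_bigr => j _ do rewrite !mxE mulr_suml.
rewrite exchange_big !rVpolyE mulr_suml riesz_sum.
apply: eq_bigr => i _; rewrite mulr_sumr riesz_sum.
apply: eq_bigr => j _; rewrite -scalerAl -scalerAr -exprD.
by rewrite !rieszZ rieszXn !mxE mulrA mulrAC.
Qed.

Lemma psd_riesz_nonneg c : psd (hankel D c) -> riesz_nonneg c D.
Proof.
move=> [_ H_ge0] p sp; have := H_ge0 (poly_rV p).
by rewrite hankel_riesz poly_rV_K.
Qed.

Lemma riesz_ker_rVpoly c x : x *m hankel D c = 0 -> riesz_ker c D (rVpoly x).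
Proof.
move=> xH0; split=> [|g sg]; first exact: size_poly.
by rewrite -(poly_rV_K sg) -hankel_riesz xH0 mul0mx mxE.
Qed.

(** The row is (0, 1), the point at infinity; as 0^0 = 1, only its last Veronese coordinate is
    nonzero. *)
Lemma veronese_inf_mul x : (veronese D (\row_i (i : nat)%:R) *m x^T) 0 0 = x 0 ord_max.
Proof.
rewrite mxE big_ord_recr big1 /= => [|i _].
  by rewrite !mxE subnn expr1n mulr1 mul1r add0r.
by rewrite !mxE /= expr0n subn_eq0 (ltn_geF (ltn_ord i)) !mul0r.
Qed.

Definition affine_point (a : R) : 'rV[R]_2 := \row_i (a ^+ i).

Lemma veronese_affine_mul a x :
  (veronese D (affine_point a) *m x^T) 0 0 = (rVpoly x).[a].
Proof.
rewrite mxE horner_rVpoly_sum; apply: eq_bigr => i _.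
by rewrite !mxE expr1n mul1r expr1 mulrC.
Qed.

Lemma veronese_sub_hankel c :
  psd (hankel D c) -> hankel D c != 0 ->
  exists2 xi, xi != 0 & (veronese D xi <= hankel D c)%MS.
Proof.
set H := hankel D c => psdH H_neq0; have [symH _] := psdH.
(* By symmetry of H, the transposed columns of [cokermx H] lie in its left kernel, so a vector
   orthogonal to that kernel is in the row space. *)
have subH xi : (forall x, x *m H = 0 -> (veronese D xi *m x^T) 0 0 = 0) ->
    (veronese D xi <= H)%MS.
  move=> ann; rewrite submxE; apply/eqP/rowP => j.
  have colj0 : (col j (cokermx H))^T *m H = 0.
    apply: trmx_inj; rewrite trmx_mul trmxK symH trmx0.
    by rewrite colE mulmxA mulmx_coker mul0mx.
  have := ann _ colj0; rewrite trmxK colE mulmxA -colE => annj.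
  by rewrite [RHS]mxE; move: annj; rewrite [LHS]mxE.
case: (riesz_ker_common_zero (psd_riesz_nonneg psdH)) => [top|[a roota]|c0].
- exists (\row_i (i : nat)%:R).
    by apply/eqP => /rowP/(_ 1); rewrite !mxE; apply/eqP/oner_neq0.
  apply: subH => x /riesz_ker_rVpoly/top.
  by rewrite veronese_inf_mul (coef_rVpoly_ord x ord_max).
- exists (affine_point a).
    by apply/eqP => /rowP/(_ 0); rewrite !mxE; apply/eqP/oner_neq0.
  by apply: subH => x /riesz_ker_rVpoly/roota/rootP; rewrite veronese_affine_mul.
- case/eqP: H_neq0; apply/matrixP => i j; rewrite !mxE c0 //.
  by rewrite -addnn leq_add // -ltnS.
Qed.

Lemma veronese_scale a xi : veronese D (a *: xi) = a ^+ D *: veronese D xi.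
Proof.
apply/rowP => i; rewrite !mxE !exprMn.
by rewrite mulrACA -exprD subnK // -ltnS.
Qed.

Lemma veronese_neq0 xi : xi != 0 -> veronese D xi != 0.
Proof.
apply: contraNneq => /rowP v0; apply/eqP/rowP => i.
have := v0 ord0; have := v0 ord_max; rewrite !mxE subnn subn0 !expr0 mul1r mulr1.
move=> /eqP; rewrite expf_eq0 => /andP[_ /eqP x1].
move=> /eqP; rewrite expf_eq0 => /andP[_ /eqP x0].
by have /orP[/eqP->|/eqP->] : (i == 0) || (i == 1) by case: i => [[|[]]].
Qed.

(** The entries depend on i + j alone, which is why deflating along the curve preserves the Hankel
    shape. *)
Lemma trmx_veronese_mul xi i j :
  ((veronese D xi)^T *m veronese D xi) i j =
  xi 0 0 ^+ (D.*2 - (i + j)) * xi 0 1 ^+ (i + j).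
Proof.
rewrite mxE big_ord1 !mxE mulrACA -!exprD; congr (_ ^+ _ * _).
by have := ltn_ord i; have := ltn_ord j; lia.
Qed.

(** Induction on the rank by deflation. Membership in the row space is carried along to separate the
    points: later Veronese vectors lie in the row space of the deflated matrix, which contains no
    nonzero multiple of the current one. *)
Lemma psd_hankel_atoms r c :
  psd (hankel D c) -> \rank (hankel D c) = r ->
  exists (lambda : 'I_r -> R) (xi : 'I_r -> 'rV[R]_2),
    [/\ forall i, 0 < lambda i,
        forall i, xi i != 0 /\ (veronese D (xi i) <= hankel D c)%MS,
        forall i j, i != j -> ~ same_proj_point (xi i) (xi j) &
        forall j, (j <= D.*2)%N ->
          c j = \sum_i lambda i * (xi i 0 0 ^+ (D.*2 - j) * xi i 0 1 ^+ j)].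
Proof.
elim: r c => [|r IHr] c psdH rankH.
  exists (fun=> 1), (fun=> 0); split=> [[]|[]|[]|j le_j] //.
  rewrite big_ord0; move/eqP: rankH; rewrite mxrank_eq0 => /eqP/matrixP H0.
  (* In rank 0 every c_j with j at most 2D is an entry of the zero matrix. *)
  have lt1 : (minn j D < D.+1)%N by rewrite ltnS geq_minr.
  have lt2 : (j - minn j D < D.+1)%N by lia.
  have := H0 (Ordinal lt1) (Ordinal lt2).
  by rewrite !mxE /= subnKC ?geq_minl.
have H_neq0 : hankel D c != 0 by rewrite -mxrank_eq0 rankH.
have [xi0 xi0_neq0 vH] := veronese_sub_hankel psdH H_neq0.
have [t t_gt0] := psd_deflate psdH (veronese_neq0 xi0_neq0) vH.
set a := fun j => c j - t * (xi0 0 0 ^+ (D.*2 - j) * xi0 0 1 ^+ j).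
have -> : hankel D c - t *: ((veronese D xi0)^T *m veronese D xi0) = hankel D a.
  by apply/matrixP => i j; rewrite mxE [X in _ + X]mxE [X in - X]mxE trmx_veronese_mul !mxE.
move=> /= [psdH']; rewrite rankH => -[/esym rankH'] leH' nvH'.
have [lambda [xi [lambda_gt0 xiP xi_neq aE]]] := IHr a psdH' rankH'.
have xi0_neq i : ~ same_proj_point xi0 (xi i) /\ ~ same_proj_point (xi i) xi0.
  have [_ vi] := xiP i; split=> -[s s_neq0 xiE].
    case/negP: nvH'; move: vi; rewrite xiE veronese_scale.
    by rewrite eqmx_scale // expf_neq0.
  by case/negP: nvH'; rewrite xiE veronese_scale scalemx_sub.
exists (fun i => oapp lambda t (unlift ord0 i)).
exists (fun i => oapp xi xi0 (unlift ord0 i)).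
split.
- by move=> i; case: unliftP => [k|] _ /=.
- move=> i; case: unliftP => [k|] _ //=.
  by have [? vk] := xiP k; split=> //; exact: submx_trans vk leH'.
- move=> i j; case: unliftP => [k|] ->; case: unliftP => [l|] -> //=.
  + by move=> kl; apply: xi_neq; apply: contraNneq kl => ->.
  + by have [] := xi0_neq k.
  + by have [] := xi0_neq l.
- move=> j le_j; rewrite big_ord_recl unlift_none /=.
  under eq_bigr => i _ do rewrite liftK /=.
  by rewrite -aE // addrC subrK.
Qed.

Lemma psd_hankel_sum r c (lambda : 'I_r -> R) (xi : 'I_r -> 'rV[R]_2) :
  (forall i, 0 < lambda i) ->
  (forall j, (j <= D.*2)%N ->
     c j = \sum_i lambda i * (xi i 0 0 ^+ (D.*2 - j) * xi i 0 1 ^+ j)) ->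
  psd (hankel D c).
Proof.
move=> lambda_gt0 cE; split=> [|x].
  by apply/matrixP => i j; rewrite !mxE addnC.
have -> : hankel D c = \sum_i lambda i *: ((veronese D (xi i))^T *m veronese D (xi i)).
  apply/matrixP => i j; rewrite summxE mxE cE; last first.
    by rewrite -addnn leq_add // -ltnS.
  by apply: eq_bigr => l _; rewrite mxE trmx_veronese_mul.
rewrite mulmx_sumr mulmx_suml summxE; apply: sumr_ge0 => i _.
set v := veronese D (xi i); rewrite -scalemxAr -scalemxAl mxE.
have -> : x *m (v^T *m v) *m x^T = (x *m v^T) *m (x *m v^T)^T.
  by rewrite trmx_mul trmxK !mulmxA.
rewrite row_sqr mulr_ge0 ?(ltW (lambda_gt0 i)) //; apply: sumr_ge0 => j _; exact: sqr_ge0.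
Qed.

End Hankel.

(** * Powers of linear forms and the reproducing property *)

Section LinearPower.
Variables (R : realType) (N : nat).
Implicit Types (v : 'rV[R]_N.+1) (a : 'X_{1..N.+1}).

Lemma mnmU1K (i : 'I_N.+1) a : (0 < a i)%N -> (U_(i) + (a - U_(i)))%MM = a.
Proof.
by move=> ai; apply/mnmP => j; rewrite mnmDE mnmBE mnm1E; case: eqP => [<-|_] /=; lia.
Qed.

Lemma mdeg_subU1 (i : 'I_N.+1) a :
  (0 < a i)%N -> mdeg a = (mdeg (a - U_(i))).+1.
Proof. by move=> ai; rewrite -[in LHS](mnmU1K ai) mdegD mdeg1. Qed.

Lemma mcoeffXUM (i : 'I_N.+1) (p : {mpoly R[N.+1]}) a :
  ('X_i * p)@_a = if (0 < a i)%N then p@_(a - U_(i)) else 0.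
Proof.
rewrite mulrC; case: ltnP => ai.
  by rewrite -[in LHS](mnmU1K ai) mcoeffMX.
rewrite mcoeffM big1 // => -[b1 b2] /= /eqP aE; rewrite mcoeffX.
case: eqP => [b2E|]; last by rewrite mulr0.
have := congr1 (fun b : 'X_{1..N.+1} => b i) aE.
by rewrite -b2E mnmDE mnm1E eqxx /=; lia.
Qed.

Lemma multinomialB1 (i : 'I_N.+1) a : (0 < a i)%N ->
  multinomial R (a - U_(i)) = (a i)%:R / (mdeg a)%:R * multinomial R a.
Proof.
move=> ai; set b := (a - U_(i))%MM.
have degE : mdeg a = (mdeg b).+1 by exact: mdeg_subU1.
have bi j : b j = (a j - (i == j))%N by rewrite mnmBE mnm1E.
rewrite /multinomial degE factS (bigD1 i) //= [in RHS](bigD1 i) //=.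
have -> : (\prod_(j < N.+1 | j != i) (b j)`! = \prod_(j < N.+1 | j != i) (a j)`!)%N.
  by apply: eq_bigr => j; rewrite eq_sym bi => /negPf ->; rewrite subn0.
rewrite -[a i](prednK ai) factS bi eqxx subn1 !natrM prednK //.
set P := (\prod_(j < N.+1 | _) _)%N.
have P_neq0 : P%:R != 0 :> R.
  by rewrite pnatr_eq0 -lt0n; apply: prodn_gt0 => j; apply: fact_gt0.
have F_neq0 : (((a i).-1)`!)%:R != 0 :> R by rewrite pnatr_eq0 -lt0n fact_gt0.
have ai_neq0 : (a i)%:R != 0 :> R by rewrite pnatr_eq0 -lt0n.
have d_neq0 : (mdeg b).+1%:R != 0 :> R by rewrite pnatr_eq0.
move: d_neq0 F_neq0 ai_neq0 P_neq0.
move: (_.+1%:R) ((a i).-1`!%:R) (a i)%:R P%:R => d F e p d0 F0 e0 p0.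
by field; rewrite d0 F0 e0 p0.
Qed.

(** The multinomial theorem, by induction on the degree: splitting off one factor weights the
    coefficient by a_i / |a|, and these weights sum to 1. *)
Lemma mcoeff_linear_form_exp v a :
  (linear_form v ^+ mdeg a)@_a = multinomial R a * \prod_i v 0 i ^+ a i.
Proof.
have [d] := ubnP (mdeg a).
elim: d a => // d IHd a; rewrite ltnS => le_ad.
have [/eqP|a_gt0] := posnP (mdeg a).
  rewrite mdeg_eq0 => /eqP ->; rewrite mdeg0 expr0 mcoeff1 eqxx /multinomial mdeg0.
  rewrite !big1 ?divr1 ?mulr1 // => i _; by rewrite mnm0E.
rewrite -(prednK a_gt0) exprS {1}/linear_form mulr_suml linear_sum /=.
have aR : (mdeg a)%:R != 0 :> R by rewrite pnatr_eq0 -lt0n.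
transitivity (\sum_i (a i)%:R / (mdeg a)%:R * (multinomial R a * \prod_i v 0 i ^+ a i)).
  apply: eq_bigr => i _; rewrite -scalerAl mcoeffZ mcoeffXUM.
  case: posnP => [->|ai]; first by rewrite mulr0 !mul0r.
  rewrite (mdeg_subU1 ai) /= IHd; last by rewrite -ltnS -(mdeg_subU1 ai).
  have prodE : v 0 i * \prod_j v 0 j ^+ (a - U_(i))%MM j = \prod_j v 0 j ^+ a j.
    rewrite (bigD1 i) //= [in RHS](bigD1 i) //= mulrA -exprS; congr (_ ^+ _ * _).
      by rewrite mnmBE mnm1E eqxx subn1 prednK.
    by apply: eq_bigr => j; rewrite eq_sym mnmBE mnm1E => /negPf ->; rewrite subn0.
  rewrite mulrCA prodE multinomialB1 // -(mdeg_subU1 ai). exact: esym (mulrA _ _ _).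
by rewrite -mulr_suml -mulr_suml -natr_sum -mdegE mulfV ?mul1r.
Qed.

Lemma linear_form_homog v d : linear_form v ^+ d \is d.-homog.
Proof.
suff: linear_form v \is 1.-homog.
  by move/(dhomogMn d); rewrite mul1n.
by apply: rpred_sum => i _; apply: rpredZ; rewrite dhomogX; apply/eqP/mdeg1.
Qed.

Definition linear_power d v : hform R N d := DHomog (linear_form_homog v d).

(** The multinomial coefficients of the power cancel the weights of the apolar product. *)
Lemma apolar_linear_power d v (g : hform R N d) :
  apolar (linear_power d v) g = (mpoly_of_dhomog g).@[v 0].
Proof.
rewrite /apolar /=; set p := mpoly_of_dhomog g.
have sp : (msize p <= d.+1)%N.
  rewrite msizeE; apply/bigmax_leqP_seq => a a_p _; rewrite ltnS.
  by rewrite (dhomog_mf (dhomog_is_dhomog g) a_p).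
rewrite {2}(mpolywE sp) raddf_sum /= big_mkcond; apply: eq_bigr => a _.
rewrite mevalZ mevalX; case: eqP => [da|/eqP da]; last first.
  by rewrite (dhomog_nemf_coeff (dhomog_is_dhomog g)) ?mul0r.
have := mcoeff_linear_form_exp v a; rewrite da => ->.
by rewrite mulKf ?multinomial_neq0 // mulrC.
Qed.

Lemma apolar_inj d : injective (@apolar R N d).
Proof.
move=> f g fg; have /eqP/lker0P inj := apolar_iso_ker R N d.
by apply: inj; apply/lfunP => x; rewrite !apolar_isoE fg.
Qed.
End LinearPower.

(** * Transport of decompositions through phi *)

Section PhiPower.
Variables (R : realType) (n m k h : nat) (q : 'I_n.+1 -> hform R m h).

(** Paired with any g, both sides evaluate g at q(xi). *)
Lemma phi_linear_power (xi : 'rV[R]_m.+1) :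
  phi k q (linear_power (h * k) xi) = linear_power k (q_eval q xi).
Proof.
apply: apolar_inj; apply: funext => g.
rewrite apolar_phi !apolar_linear_power lfunE /= comp_mpoly_meval.
by apply: meval_eq => i; rewrite tnth_mktuple mxE.
Qed.

(** [phi] is the apolar adjoint of [W], and the adjoint of a surjection is injective. *)
Lemma phi_inj : limg (W k q) = fullv -> injective (phi k q).
Proof.
move=> W_surj f g fg; apply: apolar_inj; apply: funext => w.
have /memv_imgP[u _ ->] : w \in limg (W k q) by rewrite W_surj memvf.
by rewrite -!apolar_phi fg.
Qed.

Lemma qSym_decompE (p : hform R n k) r (lambda : 'I_r -> R) (xi : 'I_r -> 'rV[R]_m.+1) :
  limg (W k q) = fullv -> p \in qSym k q ->
  (mpoly_of_dhomog p = \sum_i lambda i *: linear_form (q_eval q (xi i)) ^+ k <->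
   mpoly_of_dhomog (psi k q p) = \sum_i lambda i *: linear_form (xi i) ^+ (h * k)).
Proof.
move=> W_surj pS; have phiK : phi k q (psi k q p) = p by exact: limg_lfunVK.
have sumE M d (v : 'I_r -> 'rV[R]_M.+1) :
    \sum_i lambda i *: linear_form (v i) ^+ d =
    mpoly_of_dhomog (\sum_i lambda i *: linear_power d (v i)).
  by rewrite linear_sum; apply: eq_bigr => i _; rewrite linearZ.
rewrite !sumE.
have phi_sum : phi k q (\sum_i lambda i *: linear_power (h * k) (xi i)) =
   \sum_i lambda i *: linear_power k (q_eval q (xi i)).
  by rewrite linear_sum; apply: eq_bigr => i _; rewrite linearZ /= phi_linear_power.
split=> /val_inj E; congr mpoly_of_dhomog.
  by apply: (phi_inj W_surj); rewrite phiK phi_sum.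
by rewrite -phiK E phi_sum.
Qed.
End PhiPower.

(** * Binary forms and moment equations *)

Lemma linear_form_exp_binary (R : realType) d (xi : 'rV[R]_2) :
  linear_form xi ^+ d =
  \sum_(j < d.+1) ('C(d, j)%:R * (xi 0 0 ^+ (d - j) * xi 0 1 ^+ j)) *:
     ('X_0 ^+ (d - j) * 'X_1 ^+ j).
Proof.
rewrite /linear_form big_ord_recl big_ord1 exprDn; apply: eq_bigr => j _.
rewrite (_ : lift ord0 ord0 = 1); last exact: val_inj.
rewrite !exprZn -scalerAl -scalerAr scalerA -scaler_nat scalerA //.
Qed.

(** The exponent of the second variable tells the monomials apart, so each coefficient can be read
    off. *)
Lemma binary_form_inj (R : realType) d (a b : nat -> R) :
  \sum_(j < d.+1) a j *: ('X_0 ^+ (d - j) * 'X_1 ^+ j) =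
  \sum_(j < d.+1) b j *: ('X_0 ^+ (d - j) * 'X_1 ^+ j) :> {mpoly R[2]} ->
  forall j, (j <= d)%N -> a j = b j.
Proof.
move=> ab j le_jd.
pose mon (i : nat) := (U_(0%R) *+ (d - i) + U_(1%R) *+ i : 'X_{1..2})%MM.
have monE i : 'X_0 ^+ (d - i) * 'X_1 ^+ i = 'X_[mon i] :> {mpoly R[2]}.
  by rewrite !mpolyXn -mpolyXD.
have mon_inj i l : (mon i == mon l) = (i == l).
  apply/eqP/eqP => [/(congr1 (fun m : 'X_{1..2} => m 1))|-> //].
  by rewrite /mon !mnmDE !mulmnE !mnm1E !mul0n !mul1n.
have coeff_mon (e : nat -> R) :
    (\sum_(i < d.+1) e i *: ('X_0 ^+ (d - i) * 'X_1 ^+ i))@_(mon j) = e j.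
  have lt_jd : (j < d.+1)%N by [].
  rewrite linear_sum (bigD1 (Ordinal lt_jd)) //= big1 => [|i ij].
    by rewrite mcoeffZ monE mcoeffX mon_inj eqxx mulr1 addr0.
  rewrite mcoeffZ monE mcoeffX mon_inj.
  by have /negPf -> : (i : nat) != j by []; rewrite mulr0.
by rewrite -(coeff_mon a) ab coeff_mon.
Qed.

Lemma sum_linear_form_exp_binary (R : realType) d r (lambda : 'I_r -> R)
    (xi : 'I_r -> 'rV[R]_2) :
  \sum_i lambda i *: linear_form (xi i) ^+ d =
  \sum_(j < d.+1)
     ('C(d, j)%:R * \sum_i lambda i * (xi i 0 0 ^+ (d - j) * xi i 0 1 ^+ j)) *:
     ('X_0 ^+ (d - j) * 'X_1 ^+ j).
Proof.
under eq_bigr => i _ do rewrite linear_form_exp_binary scaler_sumr.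
rewrite exchange_big; apply: eq_bigr => j _ /=.
rewrite mulr_sumr scaler_suml; apply: eq_bigr => i _.
by rewrite scalerA mulrCA.
Qed.

(** Comparing coefficients, the binomials cancel, being nonzero for j at most d. *)
Lemma binary_form_momentE (R : realType) d r (c : nat -> R)
    (lambda : 'I_r -> R) (xi : 'I_r -> 'rV[R]_2) :
  (\sum_(j < d.+1) ('C(d, j)%:R * c j) *: ('X_0 ^+ (d - j) * 'X_1 ^+ j) =
   \sum_i lambda i *: linear_form (xi i) ^+ d) <->
  forall j, (j <= d)%N ->
    c j = \sum_i lambda i * (xi i 0 0 ^+ (d - j) * xi i 0 1 ^+ j).
Proof.
rewrite sum_linear_form_exp_binary; split=> [E j le_jd | cE].
  have := binary_form_inj (a := fun j => 'C(d, j)%:R * c j)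
    (b := fun j => 'C(d, j)%:R * \sum_i lambda i * (xi i 0 0 ^+ (d - j) * xi i 0 1 ^+ j))
    E le_jd.
  by apply: mulfI; rewrite pnatr_eq0 -lt0n bin_gt0.
by apply: eq_bigr => j _; rewrite -cE // -ltnS.
Qed.

(** * Positive decompositions and the Hankel matrix *)

Theorem proposition3p30 (R : realType) (n k h : nat)
    (hn : (0 < n)%N) (hk : (0 < k)%N) (hh : (0 < h)%N) (k_even : ~~ odd k)
    (q : 'I_n.+1 -> hform R 1 h)
    (W_surj : limg (W k q) = fullv)
    (p : hform R n k) (p_qSym : p \in qSym k q) (p_neq0 : p != 0)
    (c : nat -> R)
    (c_psi : mpoly_of_dhomog (psi k q p) =
       \sum_(j < (h * k).+1)
          ('C(h * k, j)%:R * c j) *: ('X_0 ^+ (h * k - j) * 'X_1 ^+ j)) :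
  ((exists r : nat, has_pos_qSym_decomp q p r) <-> psd (Hankel (h * k) c)) /\
  (psd (Hankel (h * k) c) ->
     has_pos_qSym_decomp q p (\rank (Hankel (h * k) c))).
Proof.
rewrite -[Hankel (h * k) c]/(hankel (h * k)./2 c).
(* Evenness of k makes the Hankel entries range over exactly c_0, ..., c_hk. *)
have hkK : (h * k)./2.*2 = (h * k)%N.
  by rewrite even_halfK // oddM (negPf k_even) andbF.
have decompE r (lambda : 'I_r -> R) (xi : 'I_r -> 'rV[R]_2) :
    mpoly_of_dhomog p = \sum_i lambda i *: linear_form (q_eval q (xi i)) ^+ k <->
    forall j, (j <= (h * k)./2.*2)%N ->
      c j = \sum_i lambda i * (xi i 0 0 ^+ ((h * k)./2.*2 - j) * xi i 0 1 ^+ j).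
  by rewrite hkK -binary_form_momentE -c_psi; exact: qSym_decompE.
have atoms : psd (hankel (h * k)./2 c) ->
    has_pos_qSym_decomp q p (\rank (hankel (h * k)./2 c)).
  move=> /psd_hankel_atoms/(_ erefl)[lambda [xi [lambda_gt0 xiP xi_neq cE]]].
  exists lambda, xi; split=> //; first by move=> i; have [] := xiP i.
  exact/decompE.
split=> //; split=> [[r [lambda [xi [lambda_gt0 _ _ /decompE cE]]]]|psdH].
  exact: psd_hankel_sum lambda_gt0 cE.
by exists (\rank (hankel (h * k)./2 c)); exact: atoms.
Qed.
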